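(* Let $\Gamma\rightrightarrows X$ be a groupoid and let $\theta$ be a partial action of a group $G$ on a set $Y$. Then the partial action groupoid $\Psi(\theta)$ is isomorphic to $\Gamma\rightrightarrows X$ if, and only if, there exists $N\in\mathcal W_\Gamma$ such that $\operatorname{red}\theta$ is isomorphic (as a partial action) to the quotient partial action $\overline{\theta^\Gamma}$ of $\theta^\Gamma$ by $(\mathcal D,N)$, where $\mathcal D$ is the diagonal relation on $X$ (i.e. $x\sim_{\mathcal D}y\Leftrightarrow x=y$).
   Context: Partial action: $\theta=(G,X,\{X_g\},\{\theta_g\})$ of a group $G$ on a set $X$ consists of subsets $X_g\subseteq X$ and bijections $\theta_g:X_{g^{-1}}\to X_g$ such that (i) $X_1=X$, $\theta_1=1_X$; (ii) $\theta_g(X_{g^{-1}}\cap X_{g^{-1}h})\subseteq X_g\cap X_h$; (iii) $\theta_g\theta_h(x)=\theta_{gh}(x)$ for $x\in X_{h^{-1}}\cap X_{h^{-1}g^{-1}}$. A morphism from $(G,X,\{X_g\},\{\alpha_g\})$ to $(S,Y,\{Y_s\},\{\beta_s\})$ is a pair $(\phi_0,\phi_1)$, $\phi_0:X\to Y$ a map, $\phi_1:G\to S$ a group homomorphism, with $\phi_0(X_g)\subseteq Y_{\phi_1(g)}$ and $\phi_0(\alpha_g(x))=\beta_{\phi_1(g)}(\phi_0(x))$ for $x\in X_{g^{-1}}$; isomorphisms are invertible morphisms. Partial action groupoid $\Psi(\theta)$: object set $X$, arrows $(\theta_g(x),g,x)$ with $g\in G$, $x\in X_{g^{-1}}$, source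 $x$, target $\theta_g(x)$, composition $(\theta_g(y),g,y)(\theta_h(x),h,x)=(\theta_{gh}(x),gh,x)$ when $y=\theta_h(x)$. $\operatorname{red}\theta$: let $\operatorname{red}G$ be the subgroup of $G$ generated by $\{g\in G:\theta_g\ne\emptyset\}$ (those $g$ with nonempty domain); $\operatorname{red}\theta$ is the restriction $(\operatorname{red}G,X,\{X_g\}_{g\in\operatorname{red}G},\{\theta_g\}_{g\in\operatorname{red}G})$. For a groupoid $\Gamma\rightrightarrows X$ with source $\operatorname{s}$ and target $\operatorname{t}$ (the product $\alpha\beta$ is defined iff $\operatorname{s}(\alpha)=\operatorname{t}(\beta)$): $G_\Gamma$ is the group generated by symbols $\lceil\gamma\rceil$ ($\gamma\in\Gamma$) with relations $\lceil1_x\rceil=1$ ($x\in X$) and $\lceil\alpha\rceil\lceil\beta\rceil=\lceil\alpha\beta\rceil$ for composable $(\alpha,\beta)$. (Distinct non-identity arrows give distinct non-trivial elements of $G_\Gamma$.) $\theta^\Gamma$ is the partial action of $G_\Gamma$ on $X$ with $X^\Gamma_1=X$, $\theta^\Gamma_1=1_X$; $X^\Gamma_{\lceil\gamma\rceil}=\{\operatorname{t}(\gamma)\}$ and $\theta^\Gamma_{\lceil\gamma\rceil}(\operatorname{s}(\gamma))=\operatorname{t}(\gamma)$ for non-identity $\gamma$; and $X^\Gamma_\omega=\varnothing$ for all other $\omega$. Put $$\mathcal W_\Gamma=\{N\trianglelefteq G_\Gamma:\ g\ne\lceil\gamma\rceil\text{ for all }g\in N\setminus\{1\}\text{ and all }\gamma\in\Gamma\}.$$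 Quotient partial action of $\alpha=(G,X,\{X_g\},\{\alpha_g\})$ by $(\mathcal R,K)$ ($\mathcal R$ an equivalence relation on $X$, $K\trianglelefteq G$): an $\mathcal R$-chain is a tuple $\mathfrak c=((x_1,g_1),\dots,(x_n,g_n))$, $n\ge1$, with $x_i\in X_{g_i}$ and $\alpha_{g_{i-1}^{-1}}(x_{i-1})\sim_{\mathcal R}x_i$ for $1<i\le n$; $\operatorname{t}(\mathfrak c)=x_1$, $\operatorname{s}(\mathfrak c)=\alpha_{g_n^{-1}}(x_n)$, $\epsilon(\mathfrak c)=g_1\cdots g_n$. $(\mathcal R,K)$ is a partial action congruence if for all $\mathcal R$-chains $\mathfrak c,\mathfrak o$ with $\epsilon(\mathfrak c)K=\epsilon(\mathfrak o)K$ one has $\operatorname{s}(\mathfrak c)\sim\operatorname{s}(\mathfrak o)\Leftrightarrow\operatorname{t}(\mathfrak c)\sim\operatorname{t}(\mathfrak o)$. In that case the quotient is the partial action of $G/K$ on $X/\mathcal R$ with $D_{\overline g}=\{\overline{\operatorname{t}(\mathfrak c)}:\overline{\epsilon(\mathfrak c)}=\overline g\}$ and maps $\overline{\operatorname{s}(\mathfrak c)}\mapsto\overline{\operatorname{t}(\mathfrak c)}$ for $\overline{\epsilon(\mathfrak c)}=\overline g$. For $N\in\mathcal W_\Gamma$, $(\mathcal D,N)$ is a partial action congruence on $\theta^\Gamma$. *)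

(* Defs.v *)
From HB Require Import structures.
From mathcomp Require Import all_boot.
From mathcomp Require Import mathcomp_extra boolp classical_sets functions.

Set Implicit Arguments.
Unset Strict Implicit.
Unset Printing Implicit Defensive.

#[local] Obligation Tactic := idtac.

Import Algebra.

Local Open Scope classical_set_scope.
Local Open Scope group_scope.

(** Quotients of types: the type of classes [R x] of a relation [R], which is
    meant to be an equivalence relation. *)

Definition quo (T : Type) (R : T -> T -> Prop) : Type :=
  {A : set T | exists x, A = R x}.

Definition cls (T : Type) (R : T -> T -> Prop) (x : T) : quo R :=
  exist _ (R x : set T) (ex_intro _ x erefl).

Lemma quo_repr_subproof (T : Type) (R : T -> T -> Prop) (a : quo R) :
  exists x, a = cls R x.
Proof. by case: a => A [x Ax]; exists x; apply: eq_exist. Qed.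

Definition quo_repr (T : Type) (R : T -> T -> Prop) (a : quo R) : T :=
  projT1 (cid (quo_repr_subproof a)).

Lemma quo_reprK (T : Type) (R : T -> T -> Prop) (a : quo R) :
  cls R (quo_repr a) = a.
Proof. by rewrite /quo_repr; case: cid. Qed.

Lemma cls_eqP (T : Type) (R : T -> T -> Prop) (x y : T) :
  RelationClasses.Equivalence R -> cls R x = cls R y <-> R x y.
Proof.
case=> Rr Rs Rt; split=> [[/(congr1 (@^~ y)) ->]|Rxy]; first exact: Rr.
apply: eq_exist; apply/funext => z; apply/propext; split => Rz.
  by apply: Rt Rz; apply: Rs.
exact: Rt Rz.
Qed.

Lemma repr_clsP (T : Type) (R : T -> T -> Prop) (x : T) :
  RelationClasses.Equivalence R -> R (quo_repr (cls R x)) x.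
Proof. by move=> eR; apply/(cls_eqP _ _ eR); rewrite quo_reprK. Qed.

HB.instance Definition _ (T : Type) (R : T -> T -> Prop) := gen_eqMixin (quo R).
HB.instance Definition _ (T : Type) (R : T -> T -> Prop) :=
  gen_choiceMixin (quo R).

Record subgroup (G : groupType) := Subgroup {
  subgroup_set :> G -> Prop;
  subgroup1 : subgroup_set 1;
  subgroupM : forall x y, subgroup_set x -> subgroup_set y ->
                          subgroup_set (x * y);
  subgroupV : forall x, subgroup_set x -> subgroup_set x^-1 }.

(** The subgroup generated by [S]: the intersection of the subgroups
    containing [S]. *)
Program Definition gen_subgroup (G : groupType) (S : set G) : subgroup G :=
  @Subgroup G [set g | forall H : subgroup G, S `<=` H -> H g] _ _ _.
Next Obligation. by move=> G S H _; apply: subgroup1. Qed.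
Next Obligation.
by move=> G S x y Sx Sy H SH; apply: subgroupM; [apply: Sx|apply: Sy].
Qed.
Next Obligation. by move=> G S x Sx H SH; apply: subgroupV; apply: Sx. Qed.

(** A subgroup seen as a group. *)
Definition subgroup_type (G : groupType) (H : subgroup G) : Type :=
  {g : G | `[< H g >]}.

HB.instance Definition _ (G : groupType) (H : subgroup G) :=
  SubChoice.on (subgroup_type H).

Lemma subgroup_closed (G : groupType) (H : subgroup G) :
  group_closed [pred g : G | `[< H g >]].
Proof.
split; first by apply/asboolP/subgroup1.
move=> x y /asboolP Hx /asboolP Hy; apply/asboolP.
by apply: subgroupM => //; apply: subgroupV.
Qed.

HB.instance Definition _ (G : groupType) (H : subgroup G) :=
  SubChoice_isSubGroup.Build G [pred g : G | `[< H g >]] (subgroup_type H)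
    (subgroup_closed H).

Record normal_subgroup (G : groupType) := NormalSubgroup {
  normal_subgroup_val :> subgroup G;
  normalJ : forall x g, normal_subgroup_val x -> normal_subgroup_val (x ^ g) }.

(** The quotient group [G / N]; the class of [g] is the left coset [g N]. *)
Definition coset_rel (G : groupType) (N : normal_subgroup G) (x y : G) : Prop :=
  N (x^-1 * y).

Definition quo_group (G : groupType) (N : normal_subgroup G) : Type :=
  quo (coset_rel N).

Definition coset (G : groupType) (N : normal_subgroup G) (g : G) :
  quo_group N := cls (coset_rel N) g.

Lemma coset_equiv (G : groupType) (N : normal_subgroup G) :
  RelationClasses.Equivalence (coset_rel N).
Proof.
split=> [x|x y Nxy|x y z Nxy Nyz]; rewrite /coset_rel.
- by rewrite mulVg; apply: subgroup1.
- by rewrite -[_ * _]invgK invgM invgK; apply: subgroupV.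
- by rewrite -(mulVKg y z) mulgA; apply: subgroupM.
Qed.

Lemma coset_repr (G : groupType) (N : normal_subgroup G) (a : quo_group N) :
  exists g, a = coset N g.
Proof. exact: quo_repr_subproof. Qed.

Definition quo_mul (G : groupType) (N : normal_subgroup G)
  (a b : quo_group N) : quo_group N := coset N (quo_repr a * quo_repr b).
Definition quo_inv (G : groupType) (N : normal_subgroup G)
  (a : quo_group N) : quo_group N := coset N (quo_repr a)^-1.

Lemma coset_eqP (G : groupType) (N : normal_subgroup G) (x y : G) :
  coset N x = coset N y <-> N (x^-1 * y).
Proof. exact: (cls_eqP _ _ (coset_equiv N)). Qed.

Lemma quo_mulE (G : groupType) (N : normal_subgroup G) (x y : G) :
  quo_mul (coset N x) (coset N y) = coset N (x * y).
Proof.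
apply/coset_eqP.
have Nx := repr_clsP x (coset_equiv N); have Ny := repr_clsP y (coset_equiv N).
rewrite -/(coset N x) /coset_rel in Nx; rewrite -/(coset N y) /coset_rel in Ny.
move: (quo_repr (coset N x)) (quo_repr (coset N y)) Nx Ny => x' y' Nx Ny.
have -> : (x' * y')^-1 * (x * y) = (x'^-1 * x) ^ y' * (y'^-1 * y).
  by rewrite /conjg invgM !mulgA mulgK.
by apply: subgroupM => //; apply: normalJ.
Qed.

Lemma quo_invE (G : groupType) (N : normal_subgroup G) (x : G) :
  quo_inv (coset N x) = coset N x^-1.
Proof.
apply/coset_eqP.
have Nx := repr_clsP x (coset_equiv N).
rewrite -/(coset N x) /coset_rel in Nx.
move: (quo_repr (coset N x)) Nx => x' Nx; rewrite invgK.
have -> : x' * x^-1 = ((x'^-1 * x)^-1) ^ x'^-1.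
  by rewrite /conjg invgM !invgK !mulgA mulgK.
by apply: normalJ; apply: subgroupV.
Qed.

Lemma quo_mulA (G : groupType) (N : normal_subgroup G) :
  associative (@quo_mul G N).
Proof.
move=> a b c; have [x ->] := coset_repr a; have [y ->] := coset_repr b.
by have [z ->] := coset_repr c; rewrite !quo_mulE mulgA.
Qed.
Lemma quo_mul1g (G : groupType) (N : normal_subgroup G) :
  left_id (coset N 1) (@quo_mul G N).
Proof. by move=> a; have [x ->] := coset_repr a; rewrite quo_mulE mul1g. Qed.
Lemma quo_mulg1 (G : groupType) (N : normal_subgroup G) :
  right_id (coset N 1) (@quo_mul G N).
Proof. by move=> a; have [x ->] := coset_repr a; rewrite quo_mulE mulg1. Qed.
Lemma quo_mulVg (G : groupType) (N : normal_subgroup G) :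
  left_inverse (coset N 1) (@quo_inv G N) (@quo_mul G N).
Proof.
by move=> a; have [x ->] := coset_repr a; rewrite quo_invE quo_mulE mulVg.
Qed.
Lemma quo_mulgV (G : groupType) (N : normal_subgroup G) :
  right_inverse (coset N 1) (@quo_inv G N) (@quo_mul G N).
Proof.
by move=> a; have [x ->] := coset_repr a; rewrite quo_invE quo_mulE mulgV.
Qed.

HB.instance Definition _ (G : groupType) (N : normal_subgroup G) :=
  Choice.on (quo_group N).
HB.instance Definition _ (G : groupType) (N : normal_subgroup G) :=
  isGroup.Build (quo_group N) (@quo_mulA G N) (@quo_mul1g G N)
    (@quo_mulg1 G N) (@quo_mulVg G N) (@quo_mulgV G N).

Lemma cosetM (G : groupType) (N : normal_subgroup G) (x y : G) :
  coset N (x * y) = coset N x * coset N y.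
Proof. by rewrite -quo_mulE. Qed.
Lemma cosetV (G : groupType) (N : normal_subgroup G) (x : G) :
  coset N x^-1 = (coset N x)^-1.
Proof. by rewrite -quo_invE. Qed.
Lemma coset1 (G : groupType) (N : normal_subgroup G) : coset N 1 = 1.
Proof. by []. Qed.

(** The group presented by generators [S] and relations [u = v] for [r u v].
    A word is a list of letters; [(false, s)] stands for [s] and [(true, s)]
    for the formal inverse of [s]. *)

Definition word (S : Type) : Type := seq (bool * S).

Inductive pres_eqv (S : Type) (r : word S -> word S -> Prop) :
    word S -> word S -> Prop :=
| pres_refl u : pres_eqv r u u
| pres_sym u v : pres_eqv r u v -> pres_eqv r v u
| pres_trans u v w : pres_eqv r u v -> pres_eqv r v w -> pres_eqv r u w
| pres_cat u u' v v' : pres_eqv r u u' -> pres_eqv r v v' ->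
    pres_eqv r (u ++ v) (u' ++ v')
| pres_cancel b s : pres_eqv r [:: (b, s); (~~ b, s)] [::]
| pres_rel u v : r u v -> pres_eqv r u v.

Definition presented (S : Type) (r : word S -> word S -> Prop) : Type :=
  quo (pres_eqv r).

Definition word_inv (S : Type) (u : word S) : word S :=
  rev [seq (~~ l.1, l.2) | l <- u].

Definition pres_class (S : Type) (r : word S -> word S -> Prop) (u : word S) :
  presented r := cls (pres_eqv r) u.

Definition pres_mul (S : Type) (r : word S -> word S -> Prop)
  (a b : presented r) : presented r := pres_class r (quo_repr a ++ quo_repr b).
Definition pres_inv (S : Type) (r : word S -> word S -> Prop)
  (a : presented r) : presented r := pres_class r (word_inv (quo_repr a)).

Lemma pres_equiv (S : Type) (r : word S -> word S -> Prop) :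
  RelationClasses.Equivalence (pres_eqv r).
Proof.
by split=> [x|x y|x y z]; [apply: pres_refl|apply: pres_sym|apply: pres_trans].
Qed.

Lemma pres_classP (S : Type) (r : word S -> word S -> Prop) (u v : word S) :
  pres_class r u = pres_class r v <-> pres_eqv r u v.
Proof. exact: (cls_eqP _ _ (pres_equiv r)). Qed.

Lemma pres_class_repr (S : Type) (r : word S -> word S -> Prop)
  (a : presented r) : exists u, a = pres_class r u.
Proof. exact: quo_repr_subproof. Qed.

Lemma word_invK (S : Type) : involutive (@word_inv S).
Proof.
move=> u; rewrite /word_inv map_rev revK -map_comp -[RHS]map_id.
by apply: eq_map => -[b s] /=; rewrite negbK.
Qed.

Lemma pres_mulV (S : Type) (r : word S -> word S -> Prop) (u : word S) :
  pres_eqv r (u ++ word_inv u) [::].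
Proof.
elim: u => [|[b s] u IH]; first exact: pres_refl.
rewrite /word_inv /= rev_cons -cats1 -/(word_inv u) catA.
apply: (@pres_trans _ _ _ ([:: (b, s)] ++ [::] ++ [:: (~~ b, s)])).
  apply: (@pres_cat _ _ [:: (b, s)]); first exact: pres_refl.
  by apply: pres_cat => //; apply: pres_refl.
exact: pres_cancel.
Qed.

Lemma pres_Vmul (S : Type) (r : word S -> word S -> Prop) (u : word S) :
  pres_eqv r (word_inv u ++ u) [::].
Proof. by rewrite -{2}(word_invK u); apply: pres_mulV. Qed.

Lemma pres_eqvV (S : Type) (r : word S -> word S -> Prop) (u v : word S) :
  pres_eqv r u v -> pres_eqv r (word_inv u) (word_inv v).
Proof.
move=> uv.
apply: (@pres_trans _ _ _ (word_inv u ++ (v ++ word_inv v))).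
  rewrite -{1}[word_inv u]cats0; apply: pres_cat; first exact: pres_refl.
  exact/pres_sym/pres_mulV.
rewrite catA -{2}[word_inv v]cat0s; apply: pres_cat; last exact: pres_refl.
apply: pres_trans (pres_Vmul r u).
by apply: pres_cat; [apply: pres_refl|apply: pres_sym].
Qed.

Lemma pres_mulE (S : Type) (r : word S -> word S -> Prop) (u v : word S) :
  pres_mul (pres_class r u) (pres_class r v) = pres_class r (u ++ v).
Proof.
by apply/pres_classP; apply: pres_cat; apply: repr_clsP; apply: pres_equiv.
Qed.
Lemma pres_invE (S : Type) (r : word S -> word S -> Prop) (u : word S) :
  pres_inv (pres_class r u) = pres_class r (word_inv u).
Proof.
by apply/pres_classP; apply: pres_eqvV; apply: repr_clsP; apply: pres_equiv.
Qed.

Lemma pres_mulA (S : Type) (r : word S -> word S -> Prop) :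
  associative (@pres_mul S r).
Proof.
move=> a b c; have [x ->] := pres_class_repr a.
have [y ->] := pres_class_repr b; have [z ->] := pres_class_repr c.
by rewrite !pres_mulE catA.
Qed.
Lemma pres_mul1g (S : Type) (r : word S -> word S -> Prop) :
  left_id (pres_class r [::]) (@pres_mul S r).
Proof. by move=> a; have [x ->] := pres_class_repr a; rewrite pres_mulE. Qed.
Lemma pres_mulg1 (S : Type) (r : word S -> word S -> Prop) :
  right_id (pres_class r [::]) (@pres_mul S r).
Proof.
by move=> a; have [x ->] := pres_class_repr a; rewrite pres_mulE cats0.
Qed.
Lemma pres_mulVg (S : Type) (r : word S -> word S -> Prop) :
  left_inverse (pres_class r [::]) (@pres_inv S r) (@pres_mul S r).
Proof.
move=> a; have [x ->] := pres_class_repr a; rewrite pres_invE pres_mulE.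
exact/pres_classP/pres_Vmul.
Qed.
Lemma pres_mulgV (S : Type) (r : word S -> word S -> Prop) :
  right_inverse (pres_class r [::]) (@pres_inv S r) (@pres_mul S r).
Proof.
move=> a; have [x ->] := pres_class_repr a; rewrite pres_invE pres_mulE.
exact/pres_classP/pres_mulV.
Qed.

HB.instance Definition _ (S : Type) (r : word S -> word S -> Prop) :=
  Choice.on (presented r).
HB.instance Definition _ (S : Type) (r : word S -> word S -> Prop) :=
  isGroup.Build (presented r) (@pres_mulA S r) (@pres_mul1g S r)
    (@pres_mulg1 S r) (@pres_mulVg S r) (@pres_mulgV S r).

(** Partial actions. [act g] represents the bijection from [dom g^-1] onto
    [dom g]; its values outside [dom g^-1] are meaningless. *)
Record partial_action (G : groupType) (X : Type) := PartialAction {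
  dom : G -> set X;
  act : G -> X -> X;
  act_bij : forall g, set_bij (dom g^-1) (dom g) (act g);
  dom1 : dom 1 = setT;
  act1 : forall x, act 1 x = x;
  act_dom : forall g h,
    act g @` (dom g^-1 `&` dom (g^-1 * h)) `<=` dom g `&` dom h;
  actM : forall g h x, (dom h^-1 `&` dom (h^-1 * g^-1)) x ->
    act g (act h x) = act (g * h) x }.

Definition pa_morphism (G S : groupType) (X Y : Type)
    (a : partial_action G X) (b : partial_action S Y)
    (phi0 : X -> Y) (phi1 : G -> S) : Prop :=
  [/\ monoid_morphism phi1,
      forall g, phi0 @` dom a g `<=` dom b (phi1 g)
    & forall g x, dom a g^-1 x ->
        phi0 (act a g x) = act b (phi1 g) (phi0 x)].

Definition pa_isomorphic (G S : groupType) (X Y : Type)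
    (a : partial_action G X) (b : partial_action S Y) : Prop :=
  exists (phi0 : X -> Y) (phi1 : G -> S) (psi0 : Y -> X) (psi1 : S -> G),
    [/\ pa_morphism a b phi0 phi1, pa_morphism b a psi0 psi1,
        cancel phi0 psi0 /\ cancel psi0 phi0
      & cancel phi1 psi1 /\ cancel psi1 phi1].

Lemma act_domV (G : groupType) (X : Type) (a : partial_action G X) g x :
  dom a g x -> dom a g^-1 (act a g^-1 x).
Proof.
by move=> gx; have [+ _ _] := act_bij a g^-1; rewrite invgK; apply.
Qed.

Lemma act_domL (G : groupType) (X : Type) (a : partial_action G X) g x :
  dom a g^-1 x -> dom a g (act a g x).
Proof. by move=> gx; have [+ _ _] := act_bij a g; apply. Qed.

Lemma actK (G : groupType) (X : Type) (a : partial_action G X) g x :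
  dom a g^-1 x -> act a g^-1 (act a g x) = x.
Proof.
move=> gx; rewrite actM; first by rewrite mulVg act1.
by split=> //; rewrite invgK mulVg dom1.
Qed.

Lemma actVK (G : groupType) (X : Type) (a : partial_action G X) g x :
  dom a g x -> act a g (act a g^-1 x) = x.
Proof. by move=> gx; rewrite -{1}[g]invgK actK // invgK. Qed.

(** [red theta]; [theta_g] is nonempty when its domain [dom theta g^-1] is. *)
Definition red_subgroup (G : groupType) (X : Type) (a : partial_action G X) :
  subgroup G := gen_subgroup [set g | dom a g^-1 !=set0].

Definition red_group (G : groupType) (X : Type) (a : partial_action G X) :
  groupType := subgroup_type (red_subgroup a).

Program Definition red (G : groupType) (X : Type) (a : partial_action G X) :
    partial_action (red_group a) X :=
  @PartialAction (red_group a) X (fun g => dom a (val g))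
    (fun g => act a (val g)) _ _ _ _ _.
Next Obligation. by move=> G X a g; exact: (act_bij a (val g)). Qed.
Next Obligation. by move=> G X a; exact: (dom1 a). Qed.
Next Obligation. by move=> G X a; exact: (act1 a). Qed.
Next Obligation. by move=> G X a g h; exact: (@act_dom _ _ a (val g) (val h)). Qed.
Next Obligation. by move=> G X a g h; exact: (@actM _ _ a (val g) (val h)). Qed.

(** Groupoids over the object set [X]; [comp a b] is the product [a b], defined
    when [src a = tgt b]. *)
Record groupoid (X : Type) := Groupoid {
  arrow :> Type;
  src : arrow -> X;
  tgt : arrow -> X;
  unit_arrow : X -> arrow;
  inv_arrow : arrow -> arrow;
  comp : forall a b : arrow, src a = tgt b -> arrow;
  src_unit : forall x, src (unit_arrow x) = x;
  tgt_unit : forall x, tgt (unit_arrow x) = x;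
  src_inv : forall a, src (inv_arrow a) = tgt a;
  tgt_inv : forall a, tgt (inv_arrow a) = src a;
  src_comp : forall a b (ab : src a = tgt b), src (comp ab) = src b;
  tgt_comp : forall a b (ab : src a = tgt b), tgt (comp ab) = tgt a;
  compA : forall a b c (ab : src a = tgt b) (bc : src b = tgt c)
    (ab_c : src (comp ab) = tgt c) (a_bc : src a = tgt (comp bc)),
    comp ab_c = comp a_bc;
  comp1l : forall a (h : src (unit_arrow (tgt a)) = tgt a), comp h = a;
  comp1r : forall a (h : src a = tgt (unit_arrow (src a))), comp h = a;
  compVl : forall a (h : src (inv_arrow a) = tgt a),
    comp h = unit_arrow (src a);
  compVr : forall a (h : src a = tgt (inv_arrow a)),
    comp h = unit_arrow (tgt a) }.

Definition groupoid_morphism (X Y : Type) (C : groupoid X) (D : groupoid Y)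
    (f0 : X -> Y) (f1 : C -> D) : Prop :=
  [/\ forall a, src (f1 a) = f0 (src a),
      forall a, tgt (f1 a) = f0 (tgt a),
      forall x, f1 (unit_arrow C x) = unit_arrow D (f0 x)
    & forall (a b : C) (ab : src a = tgt b) (fab : src (f1 a) = tgt (f1 b)),
        f1 (comp ab) = comp fab].

Definition groupoid_isomorphic (X Y : Type) (C : groupoid X) (D : groupoid Y) :
    Prop :=
  exists (f0 : X -> Y) (f1 : C -> D) (k0 : Y -> X) (k1 : D -> C),
    [/\ groupoid_morphism f0 f1, groupoid_morphism k0 k1,
        cancel f0 k0 /\ cancel k0 f0 & cancel f1 k1 /\ cancel k1 f1].

(** The partial action groupoid. The arrow [(theta_g x, g, x)] is determined by
    [g] and [x], so its first component is not stored. *)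
Record pa_arrow (G : groupType) (X : Type) (a : partial_action G X) := PaArrow {
  pa_elt : G;
  pa_src : X;
  pa_srcP : dom a pa_elt^-1 pa_src }.

Definition pa_tgt (G : groupType) (X : Type) (a : partial_action G X)
  (p : pa_arrow a) : X := act a (pa_elt p) (pa_src p).

Lemma pa_arrow_eq (G : groupType) (X : Type) (a : partial_action G X)
  (p q : pa_arrow a) : pa_elt p = pa_elt q -> pa_src p = pa_src q -> p = q.
Proof.
case: p q => [g x gx] [h y hy] /= gh xy; subst h y.
by congr PaArrow; apply: Prop_irrelevance.
Qed.

Lemma pa_unit_subproof (G : groupType) (X : Type) (a : partial_action G X) x :
  dom a 1^-1 x.
Proof. by rewrite invg1 dom1. Qed.

Lemma pa_inv_subproof (G : groupType) (X : Type) (a : partial_action G X)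
  (p : pa_arrow a) : dom a (pa_elt p)^-1^-1 (pa_tgt p).
Proof. by rewrite invgK; apply: act_domL; apply: pa_srcP. Qed.

Lemma pa_comp_dom (G : groupType) (X : Type) (a : partial_action G X) g h x :
  dom a h^-1 x -> dom a g^-1 (act a h x) -> dom a (g * h)^-1 x.
Proof.
move=> hx ghx; rewrite invgM.
have [] := @act_dom _ _ a h^-1 (h^-1 * g^-1) x; last by [].
exists (act a h x); last exact: actK.
by split; rewrite invgK ?mulVKg//; apply: act_domL.
Qed.

Lemma pa_comp_subproof (G : groupType) (X : Type) (a : partial_action G X)
  (p q : pa_arrow a) : pa_src p = pa_tgt q ->
  dom a (pa_elt p * pa_elt q)^-1 (pa_src q).
Proof.
move=> pq; apply: pa_comp_dom; first exact: pa_srcP.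
by rewrite -/(pa_tgt q) -pq; apply: pa_srcP.
Qed.

Lemma pa_actM (G : groupType) (X : Type) (a : partial_action G X) g h x :
  dom a h^-1 x -> dom a g^-1 (act a h x) ->
  act a (g * h) x = act a g (act a h x).
Proof.
move=> hx ghx; rewrite actM //; split=> //.
by rewrite -invgM; apply: pa_comp_dom.
Qed.

Definition pa_unit (G : groupType) (X : Type) (a : partial_action G X) (x : X) :
  pa_arrow a := PaArrow (pa_unit_subproof a x).
Definition pa_inv (G : groupType) (X : Type) (a : partial_action G X)
  (p : pa_arrow a) : pa_arrow a := PaArrow (pa_inv_subproof p).
Definition pa_comp (G : groupType) (X : Type) (a : partial_action G X)
  (p q : pa_arrow a) (pq : pa_src p = pa_tgt q) : pa_arrow a :=
  PaArrow (pa_comp_subproof pq).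

Program Definition pa_groupoid (G : groupType) (X : Type)
    (a : partial_action G X) : groupoid X :=
  @Groupoid X (pa_arrow a) (@pa_src G X a) (@pa_tgt G X a) (@pa_unit G X a)
    (@pa_inv G X a) (@pa_comp G X a) _ _ _ _ _ _ _ _ _ _ _.
Next Obligation. by []. Qed.
Next Obligation. by move=> G X a x; apply: act1. Qed.
Next Obligation. by []. Qed.
Next Obligation. by move=> G X a p; apply: actK; apply: pa_srcP. Qed.
Next Obligation. by []. Qed.
Next Obligation.
move=> G X a p q pq /=; rewrite /pa_tgt /=.
rewrite pa_actM -/(pa_tgt q) -?pq //; apply: pa_srcP.
Qed.
Next Obligation. by move=> *; apply: pa_arrow_eq; rewrite /= ?mulgA. Qed.
Next Obligation. by move=> *; apply: pa_arrow_eq; rewrite /= ?mul1g. Qed.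
Next Obligation. by move=> *; apply: pa_arrow_eq; rewrite /= ?mulg1. Qed.
Next Obligation. by move=> *; apply: pa_arrow_eq; rewrite /= ?mulVg. Qed.
Next Obligation. by move=> *; apply: pa_arrow_eq; rewrite /= ?mulgV. Qed.

(** The group [G_Gamma]; [bracket a] is the generator attached to [a]. *)
Inductive univ_rel (X : Type) (C : groupoid X) : word C -> word C -> Prop :=
| univ_unit x : univ_rel [:: (false, unit_arrow C x)] [::]
| univ_comp (a b : C) (ab : src a = tgt b) :
    univ_rel [:: (false, a); (false, b)] [:: (false, comp ab)].

Definition univ_group (X : Type) (C : groupoid X) : groupType :=
  presented (@univ_rel X C).

Definition bracket (X : Type) (C : groupoid X) (a : C) : univ_group C :=
  pres_class (@univ_rel X C) [:: (false, a)].

Definition is_unit (X : Type) (C : groupoid X) (a : C) : Prop :=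
  exists x, a = unit_arrow C x.

Lemma comp_eq (X : Type) (C : groupoid X) (a a' b b' : C)
  (h : src a = tgt b) (h' : src a' = tgt b') :
  a = a' -> b = b' -> comp h = comp h'.
Proof. by move=> aa bb; subst a' b'; congr comp; apply: Prop_irrelevance. Qed.

Lemma comp_unitl (X : Type) (C : groupoid X) (a b : C) (h : src a = tgt b) :
  is_unit a -> comp h = b.
Proof.
case=> x ax; subst a; have xb : x = tgt b by rewrite -h src_unit.
subst x.
exact: comp1l.
Qed.

Lemma comp_unitr (X : Type) (C : groupoid X) (a b : C) (h : src a = tgt b) :
  is_unit b -> comp h = a.
Proof.
case=> x bx; subst b; have xa : x = src a by rewrite h tgt_unit.
subst x.
exact: comp1r.
Qed.

Lemma bracket_unit (X : Type) (C : groupoid X) (a : C) :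
  is_unit a -> bracket a = 1.
Proof. by case=> x ->; apply/pres_classP/pres_rel; apply: univ_unit. Qed.

Lemma bracket_comp (X : Type) (C : groupoid X) (a b : C) (h : src a = tgt b) :
  bracket (comp h) = bracket a * bracket b.
Proof.
rewrite /mul /= pres_mulE; apply/esym/pres_classP/pres_rel.
exact: univ_comp.
Qed.

Lemma bracketV (X : Type) (C : groupoid X) (a : C) :
  bracket (inv_arrow a) = (bracket a)^-1.
Proof.
apply: (mulgI (bracket a)); rewrite mulgV.
have h : src a = tgt (inv_arrow a) by rewrite tgt_inv.
rewrite -(bracket_comp h) compVr; apply: bracket_unit.
by exists (tgt a).
Qed.

(** [bracket] separates non-identity arrows: the universal group acts on
    reduced words, and [bracket a] maps the empty word to [a]. *)
Definition push_cons (X : Type) (C : groupoid X) (a : C) (w : seq C) : seq C :=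
  if pselect (is_unit a) then w else a :: w.

Definition push (X : Type) (C : groupoid X) (a : C) (w : seq C) : seq C :=
  if w is b :: w' then
    match pselect (src a = tgt b) with
    | left h => push_cons (comp h) w'
    | right _ => push_cons a w
    end
  else push_cons a w.

Fixpoint reduced (X : Type) (C : groupoid X) (w : seq C) : Prop :=
  if w is a :: w' then
    [/\ ~ is_unit a, (if w' is b :: _ then src a <> tgt b else True)
      & reduced w']
  else True.

Lemma push_consU (X : Type) (C : groupoid X) (a : C) (w : seq C) :
  is_unit a -> push_cons a w = w.
Proof. by rewrite /push_cons; case: pselect. Qed.

Lemma push_consN (X : Type) (C : groupoid X) (a : C) (w : seq C) :
  ~ is_unit a -> push_cons a w = a :: w.
Proof. by rewrite /push_cons; case: pselect. Qed.

Lemma pushE (X : Type) (C : groupoid X) (a : C) (w : seq C) :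
  (if w is b :: _ then src a <> tgt b else True) -> push a w = push_cons a w.
Proof. by case: w => //= b w ab; case: pselect. Qed.

Lemma pushh (X : Type) (C : groupoid X) (a b : C) (w : seq C)
  (h : src a = tgt b) : push a (b :: w) = push_cons (comp h) w.
Proof.
rewrite /=; case: pselect => // h'.
by rewrite (comp_eq h' h).
Qed.

Lemma push_unit (X : Type) (C : groupoid X) (a : C) (w : seq C) :
  is_unit a -> reduced w -> push a w = w.
Proof.
case: w => [|b w] ua //=; first by rewrite /push_cons; case: pselect.
case=> ub _ _; case: pselect => [h|_]; rewrite /push_cons.
  by rewrite comp_unitl //; case: pselect.
by case: pselect.
Qed.

Lemma push_reduced (X : Type) (C : groupoid X) (a : C) (w : seq C) :
  reduced w -> reduced (push a w).
Proof.
case: w => [|b w] /=; first by rewrite /push_cons; case: pselect.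
case=> ub bw rw; case: pselect => [h|nh]; rewrite /push_cons; case: pselect => //=.
by move=> nu; split=> //; case: w bw {rw} => // c w; rewrite src_comp.
Qed.

Lemma push_comp (X : Type) (C : groupoid X) (a b : C) (w : seq C)
  (h : src a = tgt b) : reduced w -> push a (push b w) = push (comp h) w.
Proof.
move=> rw.
have [ub|nub] := pselect (is_unit b).
  by rewrite (push_unit ub) // comp_unitr.
have [ua|nua] := pselect (is_unit a).
  by rewrite (push_unit ua) ?comp_unitl//; apply: push_reduced.
have nil_case (w' : seq C) : push a (b :: w') = push_cons (comp h) w'.
  exact: pushh.
case: w rw => [_|c w rcw].
  by rewrite (@pushE _ _ b) // (push_consN _ nub) nil_case.
have [nuc cw rw] := rcw.
have sab : src (comp h) = src b by apply: src_comp.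
have [bc|nbc] := pselect (src b = tgt c); last first.
  rewrite (@pushE _ _ b) // (push_consN _ nub) nil_case pushE //.
  by rewrite sab.
have abc : src (comp h) = tgt c by rewrite sab.
have a_bc : src a = tgt (comp bc) by rewrite tgt_comp.
rewrite (pushh w bc) (pushh w abc) (compA abc a_bc).
have [ubc|nubc] := pselect (is_unit (comp bc)).
  rewrite (push_consU _ ubc) (comp_unitr a_bc ubc) pushE //.
  case: w cw {rw rcw} => // d w.
  suff -> : src a = src c by [].
  case: ubc => x e.
  by rewrite h -(tgt_comp bc) -(src_comp bc) e tgt_unit src_unit.
by rewrite (push_consN _ nubc) (pushh w a_bc).
Qed.

Fixpoint ev_word (X : Type) (C : groupoid X) (u : word C) (w : seq C) : seq C :=
  if u is (b, a) :: u' then push (if b then inv_arrow a else a) (ev_word u' w)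
  else w.

Lemma ev_word_cat (X : Type) (C : groupoid X) (u v : word C) (w : seq C) :
  ev_word (u ++ v) w = ev_word u (ev_word v w).
Proof. by elim: u => [|[b a] u IH] //=; rewrite IH. Qed.

Lemma ev_word_reduced (X : Type) (C : groupoid X) (u : word C) (w : seq C) :
  reduced w -> reduced (ev_word u w).
Proof. by move=> rw; elim: u => [|[b a] u IH] //=; apply: push_reduced. Qed.

Lemma ev_word_eqv (X : Type) (C : groupoid X) (u v : word C) :
  pres_eqv (@univ_rel X C) u v ->
  forall w, reduced w -> ev_word u w = ev_word v w.
Proof.
elim=> {u v} [//|u v _ IH w rw|u v t _ IH1 _ IH2 w rw
  |u u' v v' _ IH1 _ IH2 w rw|b a w rw|u v].
- by rewrite IH.
- by rewrite IH1 // IH2.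
- by rewrite !ev_word_cat IH2 // IH1 //; apply: ev_word_reduced.
- have h1 : src a = tgt (inv_arrow a) by rewrite tgt_inv.
  have h2 : src (inv_arrow a) = tgt a by rewrite src_inv.
  case: b => /=.
    by rewrite (push_comp h2) // compVl push_unit //; exists (src a).
  by rewrite (push_comp h1) // compVr push_unit //; exists (tgt a).
- case=> [x|a b ab] w rw /=; first by rewrite push_unit //; exists x.
  by rewrite (push_comp ab).
Qed.

Lemma bracket_push (X : Type) (C : groupoid X) (a b : C) :
  bracket a = bracket b -> push_cons a [::] = push_cons b [::].
Proof. by move=> /pres_classP /ev_word_eqv /(_ [::] I). Qed.

Lemma bracket_inj (X : Type) (C : groupoid X) (a b : C) :
  ~ is_unit a -> bracket a = bracket b -> a = b.
Proof.
move=> nua /bracket_push; rewrite (push_consN _ nua) /push_cons.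
by case: pselect => // _ [].
Qed.

Lemma bracket_eq1 (X : Type) (C : groupoid X) (a : C) :
  bracket a = 1 -> is_unit a.
Proof.
move=> a1; have [//|nua] := pselect (is_unit a).
suff : push_cons a [::] = [::] by rewrite /push_cons; case: pselect.
have -> : [::] = ev_word [::] ([::] : seq C) by [].
have := @ev_word_eqv X C [:: (false, a)] [::] _ [::] I; apply.
exact/pres_classP.
Qed.

(** The partial action of the universal group on the objects. *)
Definition univ_dom (X : Type) (C : groupoid X) (g : univ_group C) : set X :=
  [set x | g = 1 \/ exists a : C, [/\ ~ is_unit a, g = bracket a & x = tgt a]].

(** [univ_act 1] is the identity, since [1] is not the [bracket] of a
    non-identity arrow; for a non-identity arrow [a], [univ_act (bracket a)] is
    constant equal to [tgt a], [a] being determined by [bracket a]. *)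
Definition univ_act (X : Type) (C : groupoid X) (g : univ_group C) (x : X) : X :=
  match pselect (exists a : C, ~ is_unit a /\ g = bracket a) with
  | left h => tgt (projT1 (cid h))
  | right _ => x
  end.

Lemma univ_domP (X : Type) (C : groupoid X) (g : univ_group C) x :
  univ_dom g x <-> exists2 a : C, g = bracket a & x = tgt a.
Proof.
split=> [[->|[a [_ -> ->]]]|[a -> ->]]; last 1 first.
- have [ua|nua] := pselect (is_unit a); last by right; exists a.
  by left; apply: bracket_unit.
- exists (unit_arrow C x); last by rewrite tgt_unit.
  by rewrite bracket_unit //; exists x.
- by exists a.
Qed.

Lemma univ_domVP (X : Type) (C : groupoid X) (g : univ_group C) x :
  univ_dom g^-1 x <-> exists2 a : C, g = bracket a & x = src a.
Proof.
split=> [/univ_domP[a ga ->]|[a -> ->]].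
  by exists (inv_arrow a); rewrite ?src_inv // bracketV -ga invgK.
by apply/univ_domP; exists (inv_arrow a); rewrite ?bracketV ?tgt_inv.
Qed.

Lemma univ_actE (X : Type) (C : groupoid X) (a : C) :
  univ_act (bracket a) (src a) = tgt a.
Proof.
rewrite /univ_act; case: pselect => [h|nh].
  by case: cid => b [nub ab] /=; rewrite (bracket_inj nub (esym ab)).
have [[x ->]|nua] := pselect (is_unit a); first by rewrite src_unit tgt_unit.
by case: nh; exists a.
Qed.

Lemma bracket_src (X : Type) (C : groupoid X) (a b : C) :
  bracket a = bracket b -> src a = src b <-> tgt a = tgt b.
Proof.
move=> ab; have [ua|nua] := pselect (is_unit a); last first.
  by rewrite (bracket_inj nua ab).
have [y yb] : is_unit b by apply: bracket_eq1; rewrite -ab bracket_unit.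
by case: ua => x ->; rewrite yb !src_unit !tgt_unit.
Qed.

Lemma univ_bij (X : Type) (C : groupoid X) (g : univ_group C) :
  set_bij (univ_dom g^-1) (univ_dom g) (univ_act g).
Proof.
split.
- move=> x /univ_domVP[a -> ->]; rewrite univ_actE.
  by apply/univ_domP; exists a.
- move=> x y /set_mem/univ_domVP[a ga ->] /set_mem/univ_domVP[b gb ->].
  rewrite {1}ga gb !univ_actE => ab.
  by apply/bracket_src => //; rewrite -ga gb.
- move=> x /univ_domP[a -> ->]; exists (src a); last exact: univ_actE.
  by apply/univ_domVP; exists a.
Qed.

Lemma univ_dom1 (X : Type) (C : groupoid X) :
  univ_dom (1 : univ_group C) = setT.
Proof. by apply/seteqP; split=> x // _; left. Qed.

Lemma univ_act1 (X : Type) (C : groupoid X) x :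
  univ_act (1 : univ_group C) x = x.
Proof.
have -> : 1 = bracket (unit_arrow C x).
  by rewrite bracket_unit //; exists x.
by rewrite -{2}(src_unit C x) univ_actE tgt_unit.
Qed.

Lemma univ_act_dom (X : Type) (C : groupoid X) (g h : univ_group C) :
  univ_act g @` (univ_dom g^-1 `&` univ_dom (g^-1 * h)) `<=`
  univ_dom g `&` univ_dom h.
Proof.
move=> _ [x [/univ_domVP[a ga xa] /univ_domP[b ghb xb]] <-].
rewrite {1}ga xa ga univ_actE; split; first by apply/univ_domP; exists a.
have ab : src a = tgt b by rewrite -xa.
apply/univ_domP; exists (comp ab); last by rewrite tgt_comp.
by rewrite bracket_comp -ghb -ga mulVKg.
Qed.

Lemma univ_actM (X : Type) (C : groupoid X) (g h : univ_group C) x :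
  (univ_dom h^-1 `&` univ_dom (h^-1 * g^-1)) x ->
  univ_act g (univ_act h x) = univ_act (g * h) x.
Proof.
rewrite -invgM => -[/univ_domVP[a ha xa] /univ_domVP[b ghb xb]].
have hab : src b = tgt (inv_arrow a) by rewrite tgt_inv -xa.
rewrite {1}ha {1}xa univ_actE ghb xb univ_actE.
have -> : g = bracket (comp hab).
  by rewrite bracket_comp bracketV -ghb -ha mulgK.
by rewrite -(src_inv a) -(src_comp hab) univ_actE tgt_comp.
Qed.

Definition univ_pa (X : Type) (C : groupoid X) :
  partial_action (univ_group C) X :=
  @PartialAction (univ_group C) X (@univ_dom X C) (@univ_act X C)
    (@univ_bij X C) (@univ_dom1 X C) (@univ_act1 X C) (@univ_act_dom X C)
    (@univ_actM X C).

Definition Wset (X : Type) (C : groupoid X) : set (normal_subgroup (univ_group C)) :=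
  [set N | forall g : univ_group C, N g -> g <> 1 ->
           forall a : C, g <> bracket a].
Arguments Wset {X} C.

(** Chains. The nonempty tuple [((x_1, g_1), ..., (x_n, g_n))] is given by its
    head [p = (x_1, g_1)] and its tail [c]. *)
Fixpoint is_chain (G : groupType) (X : Type) (a : partial_action G X)
    (R : X -> X -> Prop) (p : X * G) (c : seq (X * G)) : Prop :=
  dom a p.2 p.1 /\
  if c is q :: c' then R (act a p.2^-1 p.1) q.1 /\ is_chain a R q c' else True.

Record chain (G : groupType) (X : Type) (a : partial_action G X)
    (R : X -> X -> Prop) := Chain {
  chain_head : X * G;
  chain_tail : seq (X * G);
  chainP : is_chain a R chain_head chain_tail }.

Definition chain_tgt (G : groupType) (X : Type) (a : partial_action G X)
  (R : X -> X -> Prop) (c : chain a R) : X := (chain_head c).1.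

Definition chain_src (G : groupType) (X : Type) (a : partial_action G X)
  (R : X -> X -> Prop) (c : chain a R) : X :=
  let p := last (chain_head c) (chain_tail c) in act a p.2^-1 p.1.

Definition chain_eps (G : groupType) (X : Type) (a : partial_action G X)
  (R : X -> X -> Prop) (c : chain a R) : G :=
  \prod_(p <- chain_head c :: chain_tail c) p.2.

Definition pa_congruence (G : groupType) (X : Type) (a : partial_action G X)
    (R : X -> X -> Prop) (K : normal_subgroup G) : Prop :=
  RelationClasses.Equivalence R /\
  forall c o : chain a R, coset K (chain_eps c) = coset K (chain_eps o) ->
    R (chain_src c) (chain_src o) <-> R (chain_tgt c) (chain_tgt o).

Lemma is_chain_cat (G : groupType) (X : Type) (a : partial_action G X)
    (R : X -> X -> Prop) p c q d :
  is_chain a R p c -> is_chain a R q d ->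
  R (act a (last p c).2^-1 (last p c).1) q.1 ->
  is_chain a R p (c ++ q :: d).
Proof.
elim: c p => [|r c IH] p /=; first by move=> [pp _] qd pq.
by move=> [pp [pr rc]] qd cq; split=> //; split=> //; apply: IH.
Qed.

Lemma chain_cat (G : groupType) (X : Type) (a : partial_action G X)
    (R : X -> X -> Prop) (c o : chain a R) :
  R (chain_src c) (chain_tgt o) ->
  exists d : chain a R, [/\ chain_src d = chain_src o,
    chain_tgt d = chain_tgt c & chain_eps d = chain_eps c * chain_eps o].
Proof.
case: c o => [p c pc] [q d qd]; rewrite /chain_src /chain_tgt /= => cq.
exists (Chain (is_chain_cat pc qd cq)).
by rewrite /chain_src /chain_eps /= last_cat /= -cat_cons big_cat.
Qed.

Lemma chain_inv (G : groupType) (X : Type) (a : partial_action G X)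
    (R : X -> X -> Prop) (c : chain a R) : RelationClasses.Equivalence R ->
  exists d : chain a R, [/\ chain_src d = chain_tgt c,
    chain_tgt d = chain_src c & chain_eps d = (chain_eps c)^-1].
Proof.
case: c => [p c pc] [Rr Rs Rt].
rewrite /chain_src /chain_tgt /chain_eps /=.
have sing (r : X * G) : dom a r.2 r.1 ->
    is_chain a R (act a r.2^-1 r.1, r.2^-1) [::].
  by move=> rr; split=> //=; apply: act_domV.
elim: c p pc => [|q c IH] p /=.
  move=> [pp _]; exists (Chain (sing _ pp)).
  by rewrite /chain_src /chain_tgt /chain_eps /= invgK actVK // !big_seq1.
case=> pp [pq /IH[d [sd td ed]]].
case: (@chain_cat _ _ a R d (Chain (sing _ pp))).
  by rewrite [chain_src d]sd /chain_tgt /=; apply: Rs.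
move=> e [se te ee]; exists e; split.
- by rewrite -/(chain_src e) se /chain_src /= invgK actVK.
- by rewrite -/(chain_tgt e) te.
- by rewrite -/(chain_eps e) ee [chain_eps d]ed /chain_eps /= big_seq1
    [in RHS]big_cons invgM.
Qed.

(** The quotient partial action: [quo_act g] maps the class of [s(c)] to that of
    [t(c)] whenever the class of [eps(c)] is [g]; the value [y] outside
    [quo_dom g^-1] is a dummy. *)
Definition quo_dom (G : groupType) (X : Type) (a : partial_action G X)
    (R : X -> X -> Prop) (K : normal_subgroup G) (g : quo_group K) :
    set (quo R) :=
  [set y | exists2 c : chain a R,
             coset K (chain_eps c) = g & y = cls R (chain_tgt c)].

Definition quo_act (G : groupType) (X : Type) (a : partial_action G X)
    (R : X -> X -> Prop) (K : normal_subgroup G) (g : quo_group K)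
    (y : quo R) : quo R :=
  match pselect (exists c : chain a R,
           coset K (chain_eps c) = g /\ y = cls R (chain_src c)) with
  | left h => cls R (chain_tgt (projT1 (cid h)))
  | right _ => y
  end.

Section QuotientPartialAction.
Variables (G : groupType) (X : Type) (a : partial_action G X).
Variables (R : X -> X -> Prop) (K : normal_subgroup G).
Hypothesis cong : pa_congruence a R K.

Let eqR : RelationClasses.Equivalence R := proj1 cong.

Lemma quo_actE (c : chain a R) :
  quo_act a (coset K (chain_eps c)) (cls R (chain_src c)) =
  cls R (chain_tgt c).
Proof.
rewrite /quo_act; case: pselect => [h|[]]; last by exists c.
case: cid => d [ed /(cls_eqP _ _ eqR) sd] /=.
by apply/(cls_eqP _ _ eqR); apply/(proj2 cong) => //; case: eqR => _ + _; apply.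
Qed.

Lemma quo_domVP (g : quo_group K) (y : quo R) :
  quo_dom a g^-1 y <-> exists2 c : chain a R,
    coset K (chain_eps c) = g & y = cls R (chain_src c).
Proof.
split=> -[c cg ->]; have [d [sd td ed]] := chain_inv c eqR; exists d.
- by rewrite ed cosetV cg invgK.
- by rewrite sd.
- by rewrite ed cosetV cg.
- by rewrite td.
Qed.

Lemma quo_bij (g : quo_group K) :
  set_bij (quo_dom (R := R) a g^-1) (quo_dom a g) (quo_act a g).
Proof.
split.
- by move=> y /quo_domVP[c <- ->]; rewrite quo_actE; exists c.
- move=> x y /set_mem/quo_domVP[c cg ->] /set_mem/quo_domVP[d dg ->].
  rewrite -{1}cg -dg !quo_actE => /(cls_eqP _ _ eqR) t.
  by apply/(cls_eqP _ _ eqR); apply/(proj2 cong) => //; rewrite cg.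
- move=> y [c <- ->]; exists (cls R (chain_src c)); last exact: quo_actE.
  by apply/quo_domVP; exists c.
Qed.

Lemma is_chain1 x : is_chain a R (x, 1) [::].
Proof. by rewrite /= dom1. Qed.

Lemma chain1E x : coset K (chain_eps (Chain (is_chain1 x))) = 1.
Proof. by rewrite /chain_eps /= big_seq1. Qed.

Lemma quo_dom1 : quo_dom a (1 : quo_group K) = [set: quo R].
Proof.
apply/seteqP; split=> y // _; have [x ->] := quo_repr_subproof y.
by exists (Chain (is_chain1 x)); first exact: chain1E.
Qed.

Lemma quo_act1 (y : quo R) : quo_act a (1 : quo_group K) y = y.
Proof.
have [x ->] := quo_repr_subproof y.
have := quo_actE (Chain (is_chain1 x)).
by rewrite chain1E /chain_src /= invg1 act1.
Qed.

Lemma quo_act_dom (g h : quo_group K) :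
  quo_act a g @` (quo_dom (R := R) a g^-1 `&` quo_dom a (g^-1 * h)) `<=`
  quo_dom a g `&` quo_dom a h.
Proof.
move=> _ [y [/quo_domVP[c cg yc] [d dh yd]] <-].
have -> : quo_act a g y = cls R (chain_tgt c) by rewrite yc -cg quo_actE.
split; first by exists c.
have [|e [_ te ee]] := @chain_cat _ _ a R c d.
  by apply/(cls_eqP _ _ eqR); rewrite -yc.
by exists e; rewrite ?te // ee cosetM cg dh mulVKg.
Qed.

Lemma quo_actM (g h : quo_group K) (y : quo R) :
  (quo_dom a h^-1 `&` quo_dom a (h^-1 * g^-1)) y ->
  quo_act a g (quo_act a h y) = quo_act a (g * h) y.
Proof.
rewrite -invgM => -[/quo_domVP[c ch yc] /quo_domVP[d dgh yd]].
have -> : quo_act a h y = cls R (chain_tgt c) by rewrite yc -ch quo_actE.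
have -> : quo_act a (g * h) y = cls R (chain_tgt d) by rewrite yd -dgh quo_actE.
have [c' [sc tc ec]] := chain_inv c eqR.
have [|e [se te ee]] := @chain_cat _ _ a R d c'.
  by apply/(cls_eqP _ _ eqR); rewrite tc -yc yd.
have -> : g = coset K (chain_eps e).
  by rewrite ee ec cosetM cosetV ch dgh mulgK.
by rewrite -sc -se quo_actE te.
Qed.

Definition quo_pa : partial_action (quo_group K) (quo R) :=
  @PartialAction (quo_group K) (quo R) (@quo_dom G X a R K)
    (@quo_act G X a R K) quo_bij quo_dom1 quo_act1 quo_act_dom quo_actM.

End QuotientPartialAction.

Definition diag_rel (X : Type) (x y : X) : Prop := x = y.

Lemma diag_chain (X : Type) (C : groupoid X)
    (c : chain (univ_pa C) (@diag_rel X)) :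
  exists a : C, [/\ chain_eps c = bracket a, chain_src c = src a
                  & chain_tgt c = tgt a].
Proof.
case: c => [p c pc]; rewrite /chain_src /chain_tgt /chain_eps /=.
have one (q : X * univ_group C) : univ_dom q.2 q.1 ->
    exists a : C, [/\ q.2 = bracket a, univ_act q.2^-1 q.1 = src a
                    & q.1 = tgt a].
  move=> /univ_domP[a qa xa]; exists a; split=> //.
  by rewrite qa xa -bracketV -src_inv univ_actE tgt_inv.
elim: c p pc => [|q c IH] p /=.
  by case=> /one[a [pa sa ta]] _; exists a; rewrite big_seq1.
case=> /one[a [pa sa ta]] [pq /IH[b [eb sb tb]]].
have ab : src a = tgt b by rewrite -sa -tb.
exists (comp ab).
by rewrite big_cons eb bracket_comp pa src_comp tgt_comp.
Qed.

Lemma Wset_congruence (X : Type) (C : groupoid X)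
    (N : normal_subgroup (univ_group C)) :
  Wset C N -> pa_congruence (univ_pa C) (@diag_rel X) N.
Proof.
move=> WN; split; first by split=> [x|x y|x y z] //; rewrite /diag_rel => ->.
move=> c o; have [a [-> -> ->]] := diag_chain c.
have [b [-> -> ->]] := diag_chain o.
have unitN (d : C) : N (bracket d) -> is_unit d.
  move=> Nd; apply: bracket_eq1; have [//|d1] := pselect (bracket d = 1).
  by case: (WN _ Nd d1 d).
move=> /coset_eqP Nab; split=> [sab|tab].
  have h : src a = tgt (inv_arrow b) by rewrite tgt_inv.
  have [x e] : is_unit (comp h).
    apply: unitN; rewrite bracket_comp bracketV.
    have -> : bracket a / bracket b =
              (((bracket a)^-1 * bracket b) ^ (bracket a)^-1)^-1.
      by rewrite /conjg !invgM !invgK !mulgA mulgK.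
    by apply: subgroupV; apply: normalJ.
  by rewrite /diag_rel -(tgt_comp h) -(src_inv b) -(src_comp h) e tgt_unit src_unit.
have h : src (inv_arrow a) = tgt b by rewrite src_inv.
have [x e] : is_unit (comp h) by apply: unitN; rewrite bracket_comp bracketV.
by rewrite /diag_rel -(tgt_inv a) -(tgt_comp h) -(src_comp h) e tgt_unit src_unit.
Qed.

(* Main.v *)
(** An isomorphism from [Psi theta] to [C] turns [(theta_g x, g, x) |-> g] into a
    functor from [C] to [red G], hence a surjective homomorphism from the
    universal group onto [red G]. Its kernel [N] meets the brackets trivially,
    because only units of [Psi theta] lie over [1], and the induced isomorphism
    from [univ_group C / N] to [red G] carries the quotient action to
    [red theta]. Conversely, chains for the diagonal relation collapse to single
    arrows, so the arrows of the groupoid of the quotient action are the pairs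
    [(bracket a N, src a)], and [N] in [Wset C] says exactly that such a pair
    determines [a]. *)
From mathcomp Require Import all_boot.
From mathcomp Require Import boolp classical_sets.
Require Import Defs.

Set Implicit Arguments.
Unset Strict Implicit.
Unset Printing Implicit Defensive.

Import Algebra.

Local Open Scope classical_set_scope.
Local Open Scope group_scope.

(** * Recognising isomorphisms from a morphism in one direction *)

Lemma groupoid_isomorphic_sym (X Y : Type) (C : groupoid X) (D : groupoid Y) :
  groupoid_isomorphic C D -> groupoid_isomorphic D C.
Proof.
by move=> [f0 [f1 [k0 [k1 [? ? [? ?] [? ?]]]]]]; exists k0, k1, f0, f1.
Qed.

(** Each functor law for the inverse on arrows, obtained by choice, can be tested after applying the
    injective [f1]. *)
Lemma bij_groupoid_isomorphic (X Y : Type) (C : groupoid X) (D : groupoid Y)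
    (f0 : X -> Y) (f1 : C -> D) (k0 : Y -> X) :
  groupoid_morphism f0 f1 -> cancel f0 k0 -> cancel k0 f0 ->
  injective f1 -> (forall d, exists c, f1 c = d) ->
  groupoid_isomorphic C D.
Proof.
move=> f01 f0K k0K f1I f1S; have [k1 k1K] := choice f1S.
exists f0, f1, k0, k1; split=> //; last by split=> // c; apply: f1I.
have [fs ft fu fc] := f01; split.
- by move=> d; rewrite -{2}(k1K d) fs f0K.
- by move=> d; rewrite -{2}(k1K d) ft f0K.
- by move=> y; apply: f1I; rewrite fu k0K k1K.
- move=> a b ab kab; apply: f1I.
  have fab : src (f1 (k1 a)) = tgt (f1 (k1 b)) by rewrite !k1K.
  by rewrite k1K (fc _ _ kab fab); apply: comp_eq; rewrite k1K.
Qed.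

(** A bijective morphism of partial actions need not be invertible, since the domains may grow along
    it. The last hypothesis says that [psi0], [psi1] also reflect domains, which is what makes the
    inverse a morphism. *)
Lemma bij_pa_isomorphic (G S : groupType) (X Y : Type)
    (a : partial_action G X) (b : partial_action S Y)
    (phi0 : X -> Y) (phi1 : G -> S) (psi0 : Y -> X) (psi1 : S -> G) :
  pa_morphism b a psi0 psi1 -> cancel phi0 psi0 -> cancel psi0 phi0 ->
  cancel phi1 psi1 -> cancel psi1 phi1 ->
  (forall s y, dom a (psi1 s) (psi0 y) -> dom b s y) ->
  pa_isomorphic a b.
Proof.
move=> psi phi0K psi0K phi1K psi1K domP.
have [[psi1_1 psi1M] psid psia] := psi.
exists phi0, phi1, psi0, psi1; split=> //.
have phi1V g : (phi1 g)^-1 = phi1 g^-1.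
  apply: (can_inj psi1K); rewrite phi1K; apply: (mulgI g).
  by rewrite mulgV -{1}(phi1K g) -psi1M mulgV psi1_1.
have domG g x : dom a g x -> dom b (phi1 g) (phi0 x).
  by move=> gx; apply: domP; rewrite phi0K phi1K.
split.
- by split=> [|g h]; apply: (can_inj psi1K); rewrite ?psi1M ?phi1K.
- by move=> g _ [x gx <-]; apply: domG.
- move=> g x gx; apply: (can_inj psi0K).
  by rewrite phi0K psia ?phi0K ?phi1K // phi1V; apply: domG.
Qed.

(** * Homomorphisms out of a presented group *)

Section PresentedLift.
Variables (S : Type) (r : word S -> word S -> Prop) (H : groupType) (f : S -> H).

Definition word_eval (u : word S) : H :=
  \prod_(l <- u) (if l.1 then (f l.2)^-1 else f l.2).

Lemma word_eval_cat u v : word_eval (u ++ v) = word_eval u * word_eval v.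
Proof. exact: big_cat. Qed.

Hypothesis fr : forall u v, r u v -> word_eval u = word_eval v.

Lemma word_eval_eqv u v : pres_eqv r u v -> word_eval u = word_eval v.
Proof.
elim=> {u v} [//|//|u v w _ -> _ -> //|u u' v v' _ Hu _ Hv|b s|u v /fr//].
- by rewrite !word_eval_cat Hu Hv.
- by rewrite /word_eval big_cons big_seq1 big_nil; case: b; rewrite ?mulVg ?mulgV.
Qed.

Definition pres_lift (a : presented r) : H := word_eval (quo_repr a).

Lemma pres_liftE u : pres_lift (pres_class r u) = word_eval u.
Proof. by apply: word_eval_eqv; apply: repr_clsP; apply: pres_equiv. Qed.

Lemma pres_lift_morphism : monoid_morphism pres_lift.
Proof.
split; first by rewrite [LHS]pres_liftE /word_eval big_nil.
move=> a b; have [u ->] := pres_class_repr a; have [v ->] := pres_class_repr b.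
by rewrite {1}/mul /= pres_mulE !pres_liftE word_eval_cat.
Qed.

End PresentedLift.

(** The defining relations of [univ_group C] are the functor laws, so a functor from [C] to a group
    factors through [bracket]. *)
Lemma univ_lift (X : Type) (C : groupoid X) (H : groupType) (f : C -> H) :
  (forall x, f (unit_arrow C x) = 1) ->
  (forall (a b : C) (ab : src a = tgt b), f (comp ab) = f a * f b) ->
  exists2 F : univ_group C -> H,
    monoid_morphism F & forall a, F (bracket a) = f a.
Proof.
move=> f1 fM.
have fr u v : univ_rel u v -> word_eval f u = word_eval f v.
  by case=> [x|a b ab]; rewrite /word_eval ?big_cons !big_nil ?mulg1 /= ?f1 ?fM.
exists (pres_lift f (r := @univ_rel X C)); first exact: pres_lift_morphism.
by move=> a; rewrite pres_liftE // /word_eval big_seq1.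
Qed.

(** * Kernels, images and the first isomorphism theorem *)

Lemma monoid_morphismV (G H : groupType) (F : G -> H) (g : G) :
  monoid_morphism F -> F g^-1 = (F g)^-1.
Proof. by move=> [F1 FM]; apply: (mulgI (F g)); rewrite -FM !mulgV. Qed.

Section KernelImage.
Variables (G H : groupType) (F : G -> H).
Hypothesis FP : monoid_morphism F.

Lemma kernel1 : F 1 = 1. Proof. by have [] := FP. Qed.
Lemma kernelM x y : F x = 1 -> F y = 1 -> F (x * y) = 1.
Proof. by have [_ ->] := FP; move=> -> ->; rewrite mulg1. Qed.
Lemma kernelV x : F x = 1 -> F x^-1 = 1.
Proof. by rewrite monoid_morphismV // => ->; rewrite invg1. Qed.
Lemma kernelJ x g : F x = 1 -> F (x ^ g) = 1.
Proof.
have [_ FM] := FP.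
by rewrite /conjg !FM monoid_morphismV // => ->; rewrite mul1g mulVg.
Qed.

Definition kernel : normal_subgroup G :=
  @NormalSubgroup G (@Subgroup G (fun g => F g = 1) kernel1 kernelM kernelV)
    kernelJ.

Lemma image1 : exists g, F g = 1. Proof. by exists 1; apply: kernel1. Qed.
Lemma imageM x y : (exists g, F g = x) -> (exists g, F g = y) ->
  exists g, F g = x * y.
Proof. by move=> [g <-] [h <-]; exists (g * h); have [_ ->] := FP. Qed.
Lemma imageV x : (exists g, F g = x) -> exists g, F g = x^-1.
Proof. by move=> [g <-]; exists g^-1; rewrite monoid_morphismV. Qed.

Definition image_subgroup : subgroup H :=
  @Subgroup H (fun h => exists g, F g = h) image1 imageM imageV.

Lemma coset_kernelP (x y : G) : coset kernel x = coset kernel y <-> F x = F y.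
Proof.
have [_ FM] := FP; rewrite coset_eqP /= FM monoid_morphismV //.
split=> [e|->]; last by rewrite mulVg.
by apply: (mulgI (F x)^-1); rewrite e mulVg.
Qed.

Definition kernel_map (c : quo_group kernel) : H := F (quo_repr c).

Lemma kernel_mapE g : kernel_map (coset kernel g) = F g.
Proof. by apply/coset_kernelP; apply: quo_reprK. Qed.

Lemma kernel_map_morphism : monoid_morphism kernel_map.
Proof.
have [F1 FM] := FP; split; first by rewrite -coset1 kernel_mapE.
move=> a b; have [x ->] := coset_repr a; have [y ->] := coset_repr b.
by rewrite -cosetM !kernel_mapE.
Qed.

Lemma kernel_map_inv : (forall h, exists g, F g = h) ->
  exists2 k : H -> quo_group kernel, cancel k kernel_map & cancel kernel_map k.
Proof.
move=> /choice[s sK]; exists (fun h => coset kernel (s h)) => [h|a].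
  by rewrite kernel_mapE.
by have [x ->] := coset_repr a; apply/coset_kernelP; rewrite sK kernel_mapE.
Qed.

End KernelImage.

(** * The quotient of the universal action by the diagonal and [N] *)

Lemma diag_equiv (X : Type) : RelationClasses.Equivalence (@diag_rel X).
Proof. by split=> [x|x y|x y z] //; rewrite /diag_rel => ->. Qed.

Lemma diag_reprK (X : Type) : cancel (cls (@diag_rel X)) (@quo_repr X (@diag_rel X)).
Proof. by move=> x; apply: (repr_clsP x (diag_equiv X)). Qed.

Section QuotientOfUniversal.
Variables (X : Type) (C : groupoid X) (N : normal_subgroup (univ_group C)).
Hypothesis WN : Wset C N.

Let pa := quo_pa (Wset_congruence WN).

(** A chain of length one suffices. Together with [diag_chain], this lets arrows replace chains in
    the description of the quotient. *)
Lemma bracket_chain (a : C) : exists c : chain (univ_pa C) (@diag_rel X),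
  [/\ chain_eps c = bracket a, chain_src c = src a & chain_tgt c = tgt a].
Proof.
have ac : is_chain (univ_pa C) (@diag_rel X) (tgt a, bracket a) [::].
  by split=> //; apply/univ_domP; exists a.
exists (Chain ac); rewrite /chain_eps /chain_src /chain_tgt /= big_seq1.
by rewrite -bracketV -src_inv univ_actE tgt_inv.
Qed.

Lemma quo_univ_domP (g : quo_group N) (y : quo (@diag_rel X)) :
  dom pa g y <-> exists2 a : C, coset N (bracket a) = g & y = cls _ (tgt a).
Proof.
split=> [[c cg ->]|[a ag ->]].
  by have [a [e _ t]] := diag_chain c; exists a; rewrite ?t -?e.
by have [c [e _ t]] := bracket_chain a; exists c; rewrite ?t ?e.
Qed.

Lemma quo_univ_domVP (g : quo_group N) (y : quo (@diag_rel X)) :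
  dom pa g^-1 y <-> exists2 a : C, coset N (bracket a) = g & y = cls _ (src a).
Proof.
rewrite quo_univ_domP; split=> -[a ag ->]; exists (inv_arrow a).
- by rewrite bracketV cosetV ag invgK.
- by rewrite src_inv.
- by rewrite bracketV cosetV ag.
- by rewrite tgt_inv.
Qed.

Lemma quo_univ_actE (a : C) :
  act pa (coset N (bracket a)) (cls _ (src a)) = cls _ (tgt a).
Proof.
have [c [<- <- <-]] := bracket_chain a.
exact: (quo_actE (Wset_congruence WN)).
Qed.

(** Equal targets make the product of the inverse of [a] with [b] defined. Its bracket lies in [N],
    hence is trivial, so the product is a unit; multiplying by [a] on the left gives [a = b]. *)
Lemma Wset_bracket_inj (a b : C) :
  coset N (bracket a) = coset N (bracket b) -> tgt a = tgt b -> a = b.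
Proof.
move=> /coset_eqP Nab tab.
have h : src (inv_arrow a) = tgt b by rewrite src_inv.
have [x e] : is_unit (comp h).
  apply: bracket_eq1; have [//|n1] := pselect (bracket (comp h) = 1).
  by have /WN/(_ n1)/(_ (comp h)) : N (bracket (comp h))
    by rewrite bracket_comp bracketV.
have ua : is_unit (comp h) by exists x.
have h' : src a = tgt (comp h) by rewrite tgt_comp tgt_inv.
have v : src a = tgt (inv_arrow a) by rewrite tgt_inv.
have v_h : src (comp v) = tgt b by rewrite src_comp src_inv.
rewrite -(comp_unitr h' ua) -(compA v_h h') comp_unitl //.
by rewrite compVr; exists (tgt a).
Qed.

End QuotientOfUniversal.

(** * The two implications *)

Section FromGroupoid.
Variables (X : Type) (C : groupoid X) (Y : Type) (G : groupType).
Variable theta : partial_action G Y.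
Let P := pa_groupoid theta.

Lemma groupoid_iso_red :
  groupoid_isomorphic P C ->
  exists (N : normal_subgroup (univ_group C)) (WN : Wset C N),
    pa_isomorphic (red theta) (quo_pa (Wset_congruence WN)).
Proof.
move=> [f0 [f1 [k0 [k1 [[fs ft _ _] [ks kt ku kc] [f0K k0K] [f1K k1K]]]]]].
(* The source of an arrow witnesses that its label has nonempty domain, so labels lie in
   [red_group theta]. *)
have eltP (p : pa_arrow theta) : `[< red_subgroup theta (pa_elt p) >].
  by apply/asboolP => H; apply; exists (pa_src p); apply: pa_srcP.
pose e (a : C) : red_group theta := Sub (pa_elt (k1 a)) (eltP (k1 a)).
have val_e a : val (e a) = pa_elt (k1 a) by [].
have [x|a b ab|F FP FE] := @univ_lift X C (red_group theta) e.
- by apply: val_inj; rewrite val_e ku.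
- have kab : src (k1 a) = tgt (k1 b) by rewrite ks kt ab.
  by apply: val_inj; rewrite val_e (kc _ _ ab kab).
have valM : monoid_morphism (fun g => val (F g)).
  by have [F1 FM] := FP; split=> [|g h]; rewrite ?F1 ?FM.
have FS h : exists g, F g = h.
  (* An element of the generated subgroup lies in every subgroup containing the generators, in
     particular in the image of [F] inside [G]. *)
  have /asboolP := valP h; move=> /(_ (image_subgroup valM)) [].
    move=> g [y gy]; exists (bracket (f1 (PaArrow gy : P))).
    by rewrite FE val_e f1K.
  by move=> g /val_inj <-; exists g.
have WN : Wset C (kernel FP).
  move=> g Ng g1 a ga; apply: g1; rewrite ga; apply: bracket_unit.
  move: Ng; rewrite /= ga FE => /(congr1 val); rewrite val_e => k1a.
  exists (f0 (pa_src (k1 a))); apply: (can_inj k1K); rewrite ku f0K.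
  exact: pa_arrow_eq.
exists (kernel FP), WN.
have [k kK FK] := kernel_map_inv FP FS.
have [F1 FM] := kernel_map_morphism FP.
pose psi0 (y : quo (@diag_rel X)) := k0 (quo_repr y).
apply: (@bij_pa_isomorphic _ _ _ _ _ _ (fun y => cls _ (f0 y)) k psi0
  (kernel_map (FP := FP))) => //.
- split=> //.
    move=> g _ [_ /quo_univ_domP[a <- ->] <-].
    rewrite kernel_mapE FE /psi0 diag_reprK -kt.
    exact: (act_domL (pa_srcP (k1 a))).
  move=> g y /quo_univ_domVP[a <- ->].
  by rewrite quo_univ_actE kernel_mapE FE /psi0 !diag_reprK -kt -ks.
- by move=> y; rewrite /psi0 diag_reprK f0K.
- by move=> y; rewrite /psi0 k0K quo_reprK.
(* Reflection of domains. The point [k0 x] should be the target of an arrow labelled [F h], but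
   [PaArrow] records sources: take the arrow labelled by the inverse of [F h] out of [k0 x], carry
   it to [C], and invert it there. *)
- move=> g y; have [h ->] := coset_repr g; have [x ->] := quo_repr_subproof y.
  rewrite kernel_mapE /psi0 diag_reprK => hx; apply/quo_univ_domP.
  have hx' : dom theta (val (F h))^-1^-1 (k0 x) by rewrite invgK.
  pose a : C := inv_arrow (f1 (PaArrow hx' : P)).
  exists a; last by rewrite /a tgt_inv fs k0K.
  apply/coset_kernelP; rewrite /a bracketV monoid_morphismV // FE.
  by apply: val_inj; rewrite /= f1K /= invgK.
Qed.

Lemma red_groupoid_iso (N : normal_subgroup (univ_group C)) (WN : Wset C N) :
  pa_isomorphic (red theta) (quo_pa (Wset_congruence WN)) ->
  groupoid_isomorphic P C.
Proof.
move=> [f0 [f1 [k0 [k1 [[f1P fd _] [k1P kd ka] [f0K k0K] [f1K k1K]]]]]].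
(* The functor is built from [C] to [P], where it has the formula sending [a] to the arrow with
   label [k1 (coset N (bracket a))] and source [k0] of the class of [src a]. *)
apply: groupoid_isomorphic_sym.
have [k11 k1M] := k1P.
have eltP (a : C) : dom theta (val (k1 (coset N (bracket a))))^-1
                              (k0 (cls _ (src a))).
  have := kd (coset N (bracket a))^-1 (k0 (cls _ (src a))).
  rewrite monoid_morphismV //; apply.
  by exists (cls _ (src a)) => //; apply/quo_univ_domVP; exists a.
pose F a : P := PaArrow (eltP a).
have Ft a : tgt (F a) = k0 (cls _ (tgt a)).
  rewrite -(quo_univ_actE WN) ka //.
  by apply/quo_univ_domVP; exists a.
apply: (@bij_groupoid_isomorphic _ _ _ _ (fun x => k0 (cls _ x)) F
  (fun y => quo_repr (f0 y))).
- split=> //.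
    move=> x; apply: pa_arrow_eq; last by rewrite /= src_unit.
    by rewrite /= bracket_unit ?coset1 ?k11 //; exists x.
  move=> a b ab Fab; apply: pa_arrow_eq; last by rewrite /= src_comp.
  by rewrite /= bracket_comp cosetM k1M.
- by move=> x; rewrite k0K diag_reprK.
- by move=> y; rewrite quo_reprK f0K.
(* Equal images have equal labels, giving equal cosets, and equal targets. *)
- move=> a b Fab; apply: (Wset_bracket_inj WN).
    by apply: (can_inj k1K); apply: val_inj; apply: (congr1 (@pa_elt _ _ _) Fab).
  apply: (can_inj (@diag_reprK X)); apply: (can_inj k0K).
  by rewrite -!Ft Fab.
(* Surjectivity: [y] shows that [g] lies in the reduced group. Moved to the quotient action, the
   domain condition on [y] supplies the arrow of [C]. *)
- case=> g y gy.
  have gP : `[< red_subgroup theta g >].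
    by apply/asboolP => H; apply; exists y.
  pose h : red_group theta := Sub g gP.
  have : dom (quo_pa (Wset_congruence WN)) (f1 h)^-1 (f0 y).
    by rewrite -monoid_morphismV //; apply: fd; exists y.
  move=> /quo_univ_domVP[a ah ay]; exists a; apply: pa_arrow_eq.
    by rewrite /= ah f1K.
  by rewrite /= -ay f0K.
Qed.

End FromGroupoid.

Theorem theorem3p9 (X : Type) (C : groupoid X) (Y : Type) (G : groupType)
    (theta : partial_action G Y) :
  groupoid_isomorphic (pa_groupoid theta) C <->
  exists (N : normal_subgroup (univ_group C)) (WN : Wset C N),
    pa_isomorphic (red theta) (quo_pa (Wset_congruence WN)).
Proof.
split; first exact: groupoid_iso_red.
by move=> [N [WN iso]]; apply: red_groupoid_iso iso.
Qed.
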